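(* Let $|\Psi\rangle$ be a non-maximally entangled two-qubit pure state (i.e. entangled but not maximally entangled), let $\Lambda$ be any qubit channel, and let $\rho^f=(\mathbf I\otimes\Lambda)(|\Psi\rangle\langle\Psi|)$ be the final state obtained when Alice sends one half of $|\Psi\rangle$ to Bob through $\Lambda$. Then the maximal average fidelity of the final state is at most that of the initial state: $F_{\rho^f}\le F_{|\Psi\rangle}$.
   Context: A qubit channel is a completely positive trace-preserving linear map $\Lambda$ on $2\times2$ complex matrices. Maximal average fidelity. For a two-qubit density matrix $\rho$ let $T_\rho$ be the real $3\times3$ matrix with entries $T_{ij}=\mathrm{Tr}(\rho\,\sigma_i\otimes\sigma_j)$ ($\sigma_1,\sigma_2,\sigma_3$ the Pauli matrices). By local unitaries $\rho$ can be brought to a canonical form $\rho_C$ with diagonal correlation matrix $\mathrm{diag}(\tau_1,\tau_2,\tau_3)$, $\tau_k=\lambda_k|t_{kk}|$, $\lambda_k\in\{\pm1\}$, where $|t_{11}|,|t_{22}|,|t_{33}|$ are the singular values of $T_\rho$; if $\det T_\rho\le 0$ all $\lambda_k=-1$, and if $\det T_\rho>0$ the $\lambda_k$ equal $-1$ for the two largest $|t_{kk}|$ and $+1$ for the smallest. The maximal average fidelity $F_\rho$ is the average teleportation fidelity (over uniformly distributed pure qubit inputs, standard teleportation protocol with shared state $\rho$, maximized over local unitaries); it is attained by $\rho_C$, and explicitly $F_\rho=\frac12\bigl(1-\frac13\sum_k\tau_k\bigr)$. For a pure state, $F_{|\Psi\rangle}$ means $F_{|\Psi\rangle\langle\Psi|}$.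 *)

(* Defs.v *)
From mathcomp Require Import all_boot all_order all_algebra.
From mathcomp Require Import sesquilinear spectral.
From mathcomp.real_closed Require Export complex.
From mathcomp.real_closed Require mxtens.
From mathcomp Require Import all_classical all_reals all_analysis.

Set Implicit Arguments.
Unset Strict Implicit.
Unset Printing Implicit Defensive.

Import Order.TTheory GRing.Theory Num.Theory.
Import numFieldNormedType.Exports.

Local Open Scope classical_set_scope.
Local Open Scope ring_scope.
Local Open Scope complex_scope.
Local Open Scope sesquilinear_scope.

(* The index of |i> (x) |j> in C^m (x) C^n is mxtens_index (i, j) = i * n + j,
   and A *t B is the Kronecker product.  In a two-qubit space 2 * 2 the first
   factor is Alice's and the second one is Bob's.  The notation of mxtens is
   restated because its companion ^t clashes with that of sesquilinear. *)
Notation tens_index i j := (mxtens.mxtens_index (i, j)).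
Notation tens_unindex k := (mxtens.mxtens_unindex k).
Notation "A *t B" := (mxtens.tensmx A B)
  (at level 40, left associativity, format "A  *t  B") : ring_scope.

Section Channels.
Variable R : realType.
Local Notation C := R[i].

Definition proj n (v : 'cV[C]_n) : 'M[C]_n := v *m v^t*.

Definition pure_state n (v : 'cV[C]_n) : Prop := v^t* *m v = 1%:M.

(* 0 <= z in C means that z is real and nonnegative, so that positivity of the
   quadratic form entails that X is Hermitian. *)
Definition psdmx n (X : 'M[C]_n) : Prop :=
  forall v : 'cV[C]_n, 0 <= (v^t* *m X *m v) 0 0.

Definition ptrace1 m n (X : 'M[C]_(m * n)) : 'M[C]_n :=
  \matrix_(b, b') \sum_(i < m) X (tens_index i b) (tens_index i b').

(* The operator (I_n (x) L)(X): L is applied to the p x p blocks of X. *)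
Definition id_tens n p q (L : 'M[C]_p -> 'M[C]_q) (X : 'M[C]_(n * p)) :
    'M[C]_(n * q) :=
  \matrix_(k, l)
    L (\matrix_(b, b') X (tens_index (tens_unindex k).1 b)
                         (tens_index (tens_unindex l).1 b'))
      (tens_unindex k).2 (tens_unindex l).2.

Definition completely_positive p q (L : 'M[C]_p -> 'M[C]_q) : Prop :=
  forall n (X : 'M[C]_(n * p)), psdmx X -> psdmx (id_tens L X).

Definition trace_preserving p q (L : 'M[C]_p -> 'M[C]_q) : Prop :=
  forall X : 'M[C]_p, \tr (L X) = \tr X.

Definition qubit_channel (L : {linear 'M[C]_2 -> 'M[C]_2}) : Prop :=
  completely_positive L /\ trace_preserving L.

Definition product_vector (Psi : 'cV[C]_(2 * 2)) : Prop :=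
  exists u v : 'cV[C]_2, Psi = u *t v.

Definition entangled (Psi : 'cV[C]_(2 * 2)) : Prop := ~ product_vector Psi.

Definition maximally_entangled (Psi : 'cV[C]_(2 * 2)) : Prop :=
  pure_state Psi /\ ptrace1 (proj Psi) = (2^-1 : C)%:M.

End Channels.

Section Teleportation.
Variable R : realType.
Local Notation C := R[i].

Definition mx22 (a b c d : C) : 'M[C]_2 :=
  \matrix_(i, j) if i == 0 then (if j == 0 then a else b)
                 else (if j == 0 then c else d).

Definition pauli (k : 'I_4) : 'M[C]_2 :=
  match val k with
  | 0 => 1%:M
  | 1 => mx22 0 1 1 0
  | 2 => mx22 0 (0 -i* 1) (0 +i* 1) 0
  | _ => mx22 1 0 0 (-1)
  end.

Definition ket (i : 'I_2) : 'cV[C]_2 := delta_mx i 0.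

Definition singlet : 'cV[C]_(2 * 2) :=
  ((Num.sqrt 2)^-1)%:C *: (ket 0 *t ket 1 - ket 1 *t ket 0).

(* Up to phases, the four Bell states. *)
Definition bell (k : 'I_4) : 'cV[C]_(2 * 2) := (pauli k *t 1%:M) *m singlet.

(* Unnormalised state of Bob's qubit after outcome k of the Bell measurement on
   the input qubit and Alice's half of rho: its trace is the probability of
   the outcome. *)
Definition bob_outcome (phi : 'cV[C]_2) (rho : 'M[C]_(2 * 2)) (k : 'I_4) :
    'M[C]_2 :=
  ptrace1 ((proj (bell k) *t 1%:M)
           *m castmx (mulnA 2 2 2, mulnA 2 2 2) (proj phi *t rho)).

(* Bob's correction for outcome k is pauli k, which is the one that teleports
   perfectly when rho is the singlet. *)
Definition teleport_output (phi : 'cV[C]_2) (rho : 'M[C]_(2 * 2)) : 'M[C]_2 :=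
  \sum_(k < 4) pauli k *m bob_outcome phi rho k *m (pauli k)^t*.

Definition teleport_fidelity (phi : 'cV[C]_2) (rho : 'M[C]_(2 * 2)) : R :=
  complex.Re ((phi^t* *m teleport_output phi rho *m phi) 0 0).

Definition bloch_ket (theta varphi : R) : 'cV[C]_2 :=
  (cos (theta / 2))%:C *: ket 0
  + ((sin (theta / 2))%:C * (cos varphi +i* sin varphi)) *: ket 1.

(* Average over the uniform probability measure on pure qubit states, which is
   sin theta dtheta dvarphi / (4 pi) on the Bloch sphere. *)
Definition average_fidelity (rho : 'M[C]_(2 * 2)) : R :=
  (4 * pi)^-1 *
  \int[@lebesgue_measure R]_(theta in `[0, pi])
    \int[@lebesgue_measure R]_(varphi in `[0, 2 * pi])
      (teleport_fidelity (bloch_ket theta varphi) rho * sin theta).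

Definition local_unitary (U V : 'M[C]_2) (rho : 'M[C]_(2 * 2)) :
    'M[C]_(2 * 2) :=
  (U *t V) *m rho *m (U *t V)^t*.

Definition max_average_fidelity (rho : 'M[C]_(2 * 2)) : R :=
  sup [set f | exists U V : 'M[C]_2,
    [/\ U \is unitarymx, V \is unitarymx
      & f = average_fidelity (local_unitary U V rho)]].

End Teleportation.

(* Main.v *)
(** The sum over the Bell outcomes twirls the shared state, so the teleportation
    fidelity of a pure input phi is the sum over k of p_k <phi|sigma_k|phi>^2,
    p_k being the weight of rho on the k-th Bell state. Averaging over the
    sphere gives (tr rho + 2 p_0) / 3, and everything reduces to the largest
    overlap with a maximally entangled state.

    Write Psi as a 2x2 coefficient matrix A, and M' for the adjoint of M. After
    local unitaries, the overlap of (I (x) Lambda)(Psi) is half of the sum over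
    b, c of the (b, c) entries of Lambda(g_b g_c'), where the g_b are the rows
    of G = Q'A for some unitary Q. The partial transpose of the state with
    coefficients G is at least -|det G|; applying I (x) Lambda to the shifted
    (positive) operator, testing on e_0 (x) e_1 - e_1 (x) e_0, and using trace
    preservation bounds that sum by tr GG' + 2 |det G| = 1 + 2 |det A|. For
    Lambda = id this is attained when Q is the unitary polar factor of A, which
    for 2x2 matrices is proportional to A + u adj(A)', u the phase of det A. *)
From mathcomp Require Import all_boot all_order all_algebra.
From mathcomp Require Import sesquilinear spectral ring.
From mathcomp.real_closed Require mxtens.
From mathcomp Require Import all_classical all_reals all_analysis.
(* Last, since [Defs.proj] is shadowed by [proj] of mathcomp.classical. *)
Require Import Defs.

Set Implicit Arguments.
Unset Strict Implicit.
Unset Printing Implicit Defensive.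

Import Order.TTheory GRing.Theory Num.Theory.
Import numFieldNormedType.Exports.

Local Open Scope ring_scope.
Local Open Scope complex_scope.
Local Open Scope sesquilinear_scope.

(** * Average over the Bloch sphere *)

Section SphereAverage.
Variable R : realType.
Local Notation mu := (@lebesgue_measure R).

Lemma Rintegral_FTC2 (f F : R -> R) (a b : R) : a < b ->
  (forall x : R, is_derive x 1 F (f x)) -> continuous f ->
  \int[mu]_(x in `[a, b]) f x = F b - F a.
Proof.
move=> ab dF cf; have cF x : {for x, continuous F}.
  by apply/differentiable_continuous/derivable1_diffP; case: (dF x).
rewrite /Rintegral (@continuous_FTC2 _ f F)//.
- exact: continuous_subspaceT.
- split=> [x _||]; first by case: (dF x).
  + exact/cvg_at_right_filter/cF.
  + exact/cvg_at_left_filter/cF.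
- by move=> x _; rewrite derive1E; apply: derive_val.
Qed.

Lemma integral_longitude (a b c : R) :
  \int[mu]_(t in `[0, 2 * pi]) (a + b * cos t ^+ 2 + c * sin t ^+ 2) =
  pi * (2 * a + b + c).
Proof.
have pi0 : (0 : R) < 2 * pi by rewrite mulr_gt0 ?pi_gt0.
(* The derivative of sin t cos t is cos^2 t - sin^2 t, so the integrand splits along the mean and
   the half-difference of b and c. *)
pose F : R -> R := (fun t => (a + (b + c) / 2) * t)
  \+ (fun t => (b - c) / 2 * (sin t * cos t)).
have dF (x : R) : is_derive x 1 F (a + b * cos x ^+ 2 + c * sin x ^+ 2).
  apply: is_derive_eq.
  rewrite /GRing.scale/=.
  have := cos2Dsin2 x. set u := cos x; set v := sin x; clearbody u v => h.
  have hv : v ^+ 2 = 1 - u ^+ 2 by rewrite -h; ring.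
  by rewrite mulrN -!expr2 hv; field.
rewrite (Rintegral_FTC2 pi0 dF).
- by rewrite /F/= [in sin _]mulr_natl sin2pi sin0; field.
- move=> x; apply: cvgD; [apply: cvgD|].
  exact: cvg_cst.
  apply: cvgM; first exact: cvg_cst.
  by apply: cvgM; exact: continuous_cos.
  apply: cvgM; first exact: cvg_cst.
  by apply: cvgM; exact: continuous_sin.
Qed.

Lemma integral_colatitude (a b : R) :
  \int[mu]_(t in `[0, pi]) ((a + b * cos t ^+ 2) * sin t) =
  2 * a + 2 / 3 * b.
Proof.
pose F : R -> R := (fun t => - a * cos t) \+ (fun t => - (b / 3) * cos t ^+ 3).
have dF (x : R) : is_derive x 1 F ((a + b * cos x ^+ 2) * sin x).
  apply: is_derive_eq.
  by rewrite /GRing.scale/=; field.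
rewrite (Rintegral_FTC2 (pi_gt0 _) dF).
- by rewrite /F/= cospi cos0; field.
- move=> x; apply: cvgM; last exact: continuous_sin.
  apply: cvgD; first exact: cvg_cst.
  apply: cvgM; first exact: cvg_cst.
  by apply: cvgM; exact: continuous_cos.
Qed.

(** The three squares are those of the coordinates of a unit vector, and each has mean 1/3 over the
    sphere. *)
Lemma sphere_average (a b c d : R) :
  (4 * pi)^-1 *
  \int[mu]_(t in `[0, pi]) \int[mu]_(p in `[0, 2 * pi])
    ((a + b * (sin t * cos p) ^+ 2 + c * (sin t * sin p) ^+ 2
      + d * cos t ^+ 2) * sin t) = a + (b + c + d) / 3.
Proof.
rewrite (@eq_Rintegral _ _ _ mu _ (fun t =>
   ((pi * (2 * a + b + c)) + (pi * (2 * d - b - c)) * cos t ^+ 2) * sin t)).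
  rewrite integral_colatitude; have := pi_gt0 R; move: (@pi R) => p p0.
  by field; rewrite gt_eqF.
move=> t _.
rewrite (@eq_Rintegral _ _ _ mu _ (fun p => ((a + d * cos t ^+ 2) * sin t) +
  (b * sin t ^+ 3) * cos p ^+ 2 + (c * sin t ^+ 3) * sin p ^+ 2)).
  rewrite integral_longitude -[sin t ^+ 3]/(sin t * (sin t ^+ 2)) sin2cos2.
  ring.
move=> p _; ring.
Qed.
End SphereAverage.

(** * The teleportation fidelity in the Bell basis *)

Section TensorIndices.

Lemma sum_tens_index (V : nmodType) m n (F : 'I_(m * n) -> V) :
  \sum_k F k = \sum_i \sum_j F (tens_index i j).
Proof.
rewrite pair_big /=.
rewrite (reindex (@mxtens.mxtens_index m n)) /=.
  by apply: eq_bigr => -[].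
exists (@mxtens.mxtens_unindex m n) => i _;
  by rewrite (mxtens.mxtens_indexK, mxtens.mxtens_unindexK).
Qed.

Lemma cast_ord_tens_index m n p (e : (m * n * p = m * (n * p))%N)
    (i : 'I_m) (j : 'I_n) (k : 'I_p) :
  cast_ord e (tens_index (tens_index i j) k) = tens_index i (tens_index j k).
Proof. by apply: val_inj => /=; rewrite mulnDl mulnA addnA. Qed.

Lemma sum_I2 (V : nmodType) (F : 'I_2 -> V) : \sum_i F i = F 0 + F 1.
Proof. by rewrite big_ord_recl big_ord1; congr (_ + F _); apply: val_inj. Qed.

Lemma sum_I4 (V : nmodType) (F : 'I_4 -> V) :
  \sum_i F i = F ord0 + F (lift ord0 ord0) + F (lift ord0 (lift ord0 ord0))
    + F (lift ord0 (lift ord0 (lift ord0 ord0))).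
Proof. by rewrite !big_ord_recl big_ord0 addr0 !addrA. Qed.

End TensorIndices.

Section Fidelity.
Variable R : realType.
Local Notation C := R[i].
Implicit Types (rho : 'M[C]_(2 * 2)) (phi : 'cV[C]_2).

Definition braket n (z : 'cV[C]_n) (X : 'M[C]_n) : C := (z^t* *m X *m z) 0 0.

Lemma adjmxE m n (A : 'M[C]_(m, n)) i j : (A^t*) i j = (A j i)^*%R.
Proof. by rewrite !mxE. Qed.

(* The vector that the Bell vector k leaves on Alice's half of rho once it is
   contracted with the input phi. *)
Definition contract_bell phi k (i : 'I_2) : C :=
  \sum_j (phi j 0)^*%R * bell R k (tens_index j i) 0.

Lemma bob_outcomeE phi rho k b b' :
  bob_outcome phi rho k b b' =
  \sum_i \sum_j (contract_bell phi k i)^*%R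
    * rho (tens_index i b) (tens_index j b') * contract_bell phi k j.
Proof.
have -> : bob_outcome phi rho k b b' =
    \sum_i1 \sum_i2 \sum_j1 \sum_j2
      bell R k (tens_index i1 i2) 0 * (bell R k (tens_index j1 j2) 0)^*%R
      * (phi j1 0 * (phi i1 0)^*%R)
      * rho (tens_index j2 b) (tens_index i2 b').
  rewrite mxE sum_tens_index.
  apply: eq_bigr => i1 _; apply: eq_bigr => i2 _.
  rewrite mxE sum_tens_index [in LHS]sum_tens_index.
  apply: eq_bigr => j1 _; apply: eq_bigr => j2 _.
  (* The identity on Bob's qubit is diagonal, so only the index b survives. *)
  rewrite (bigD1 b) //= big1 ?addr0; last first.
    by move=> c cb; rewrite mxtens.tensmxE !mxE eq_sym (negbTE cb) mulr0 mul0r.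
  rewrite castmxE !cast_ord_tens_index !mxtens.tensmxE [(1%:M) _ _]mxE eqxx.
  by rewrite mulr1 !mxE !big_ord1 !mxE mulrA.
rewrite /contract_bell !sum_I2 !(rmorphM, rmorphD) /= !conjCK.
ring.
Qed.

Lemma braketE n (z : 'cV[C]_n) (X : 'M[C]_n) :
  braket z X = \sum_i \sum_j (z i 0)^*%R * X i j * z j 0.
Proof.
rewrite /braket -mulmxA mxE.
apply: eq_bigr => i _; rewrite adjmxE [(X *m z) _ _]mxE mulr_sumr.
by apply: eq_bigr => j _; rewrite mulrA.
Qed.

Lemma braket_tens (z : 'cV[C]_(2 * 2)) rho :
  braket z rho = \sum_i \sum_b \sum_j \sum_b'
    (z (tens_index i b) 0)^*%R * rho (tens_index i b) (tens_index j b')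
     * z (tens_index j b') 0.
Proof.
rewrite braketE sum_tens_index.
apply: eq_bigr => i _; apply: eq_bigr => b _; exact: sum_tens_index.
Qed.

Lemma bellE k i j : bell R k (tens_index i j) 0 =
  ((Num.sqrt 2)^-1)%:C
  * (pauli R k i 0 * (j == 1)%:R - pauli R k i 1 * (j == 0)%:R).
Proof.
rewrite mxE sum_tens_index !sum_I2.
rewrite !mxtens.tensmxE !mxE !mxtens.mxtens_indexK /=.
ring.
Qed.

Lemma pauliE (k : 'I_4) : pauli R k =
  nth 0 [:: 1%:M; mx22 0 1 1 0; mx22 0 (- 'i%C) 'i%C 0; mx22 1 0 0 (-1)] k.
Proof.
have iN : 0 -i* 1 = - 'i%C :> C by apply/eqP; rewrite eq_complex /= oppr0 !eqxx.
by case: k => [[|[|[|[|]]]] //= ?]; rewrite /pauli/= ?iN.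
Qed.

Lemma ord2P (P : 'I_2 -> Prop) : P 0 -> P 1 -> forall i, P i.
Proof.
move=> P0 P1 [[|[|//]] lt_i2].
  by have -> : Ordinal lt_i2 = 0 by exact: val_inj.
by have -> : Ordinal lt_i2 = 1 by exact: val_inj.
Qed.

(** Outcome k, its correction and the overlap with [phi] amount to testing the shared state on this
    one vector: the contraction on Alice's side, the input pulled back through the correction on
    Bob's. *)
Definition bob_ket phi (k : 'I_4) : 'cV[C]_(2 * 2) :=
  (\col_i contract_bell phi k i) *t ((pauli R k)^t* *m phi).

Lemma bob_ketE phi k i b : bob_ket phi k (tens_index i b) 0 =
  contract_bell phi k i * \sum_c (pauli R k c b)^*%R * phi c 0.
Proof.
rewrite !mxE mxtens.mxtens_indexK /=; congr (_ * _).
by apply: eq_bigr => c _; rewrite adjmxE; congr (_ * phi _ _); apply: val_inj.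
Qed.

Lemma braket_bob_ket phi rho k :
  braket phi (pauli R k *m bob_outcome phi rho k *m (pauli R k)^t*) =
  braket (bob_ket phi k) rho.
Proof.
have -> : braket phi (pauli R k *m bob_outcome phi rho k *m (pauli R k)^t*) =
    braket ((pauli R k)^t* *m phi) (bob_outcome phi rho k).
  have uE : ((pauli R k)^t* *m phi)^t* = phi^t* *m pauli R k.
    rewrite trmx_mul map_mxM; congr (_ *m _).
    by apply/matrixP => i j; rewrite !mxE; apply: conjCK.
  by rewrite /braket uE !mulmxA.
rewrite braketE braket_tens.
rewrite !sum_I2 !bob_outcomeE !bob_ketE !sum_I2.
rewrite ![(_ *m phi) _ _]mxE !sum_I2 !adjmxE.
rewrite !(rmorphM, rmorphD) /= !conjCK.
move: (contract_bell _ _ 0) (contract_bell _ _ 1) => c0 c1.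
move: (pauli R k 0 0) (pauli R k 0 1) => p q.
move: (pauli R k 1 0) (pauli R k 1 1) => r s.
ring.
Qed.

Local Notation s := (((Num.sqrt 2)^-1)%:C : C).
Local Notation I := (complex.Complex 0 1 : C).

Let conj_s : s^*%R = s.
Proof. exact: conjc_real. Qed.

Let conj_I : I^*%R = - I.
Proof. by apply/eqP; rewrite eq_complex /= oppr0 !eqxx. Qed.

(* The inner lists are indexed by the basis kets 00, 01, 10, 11. *)
Lemma bell_values k i b : bell R k (tens_index i b) 0 =
  s * nth 0 (nth [::] [:: [:: 0; 1; -1; 0]; [:: -1; 0; 0; 1];
                          [:: I; 0; 0; I]; [:: 0; 1; 1; 0]] k) (i * 2 + b).
Proof.
rewrite bellE pauliE; congr (_ * _).
by elim/ord2P: i; elim/ord2P: b; case: k => [[|[|[|[|//]]]] ?] /=;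
  rewrite !mxE /=; ring.
Qed.

(** Conjugation is opaque to [ring], so the conjugate table is precomputed; only the row k = 2,
    which contains i, changes. *)
Lemma conj_bell_values k i b : (bell R k (tens_index i b) 0)^*%R =
  s * nth 0 (nth [::] [:: [:: 0; 1; -1; 0]; [:: -1; 0; 0; 1];
                          [:: - I; 0; 0; - I]; [:: 0; 1; 1; 0]] k) (i * 2 + b).
Proof.
rewrite bell_values rmorphM /= conj_s; congr (_ * _).
by elim/ord2P: i; elim/ord2P: b; case: k => [[|[|[|[|//]]]] ?] /=;
  rewrite ?(rmorphN, rmorph0, rmorph1) //= ?rmorph1 ?conj_I.
Qed.

(** For a unit vector these are 1 and the three Bloch coordinates of [phi]. *)
Lemma braket_pauli_values phi k (x := phi 0 0) (y := phi 1 0) :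
  braket phi (pauli R k) =
  nth 0 [:: x^*%R * x + y^*%R * y; x^*%R * y + y^*%R * x;
            I * (y^*%R * x - x^*%R * y); x^*%R * x - y^*%R * y] k.
Proof.
rewrite braketE !sum_I2 pauliE.
by case: k => [[|[|[|[|//]]]] ?] /=; rewrite !mxE /= -/x -/y; ring.
Qed.

(** In row k = 2 the factor i of the Bell vector meets that of the Pauli matrix, so the table is
    free of i. *)
Lemma bob_ket_values phi k i b (x := phi 0 0) (y := phi 1 0) :
  bob_ket phi k (tens_index i b) 0 =
  s * nth 0 (nth [::]
    [:: [:: - (y^*%R * x); - (y^*%R * y); x^*%R * x; x^*%R * y];
        [:: - (x^*%R * y); - (x^*%R * x); y^*%R * y; y^*%R * x];
        [:: x^*%R * y; - (x^*%R * x); y^*%R * y; - (y^*%R * x)];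
        [:: y^*%R * x; - (y^*%R * y); x^*%R * x; - (x^*%R * y)]] k) (i * 2 + b).
Proof.
have I2 : I * I = - 1 by rewrite -expr2 sqr_i.
rewrite bob_ketE /contract_bell !sum_I2 !bell_values pauliE.
by elim/ord2P: i; elim/ord2P: b; case: k => [[|[|[|[|//]]]] ?] /=;
  rewrite !mxE /= ?(rmorphN, rmorph0, rmorph1, conjC1, conjC0) /=;
  rewrite ?conj_I ?conjC1 -/x -/y; ring: I2.
Qed.

Lemma conj_bob_ket_values phi k i b (x := phi 0 0) (y := phi 1 0) :
  (bob_ket phi k (tens_index i b) 0)^*%R =
  s * nth 0 (nth [::]
    [:: [:: - (y * x^*%R); - (y * y^*%R); x * x^*%R; x * y^*%R];
        [:: - (x * y^*%R); - (x * x^*%R); y * y^*%R; y * x^*%R];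
        [:: x * y^*%R; - (x * x^*%R); y * y^*%R; - (y * x^*%R)];
        [:: y * x^*%R; - (y * y^*%R); x * x^*%R; - (x * y^*%R)]] k) (i * 2 + b).
Proof.
rewrite bob_ket_values rmorphM /= conj_s; congr (_ * _).
by elim/ord2P: i; elim/ord2P: b; case: k => [[|[|[|[|//]]]] ?] /=;
  rewrite ?(rmorphN, rmorphM) /= ?rmorphM /= conjCK.
Qed.

(* The Pauli twirl: the projector on bob_ket k is diagonal in the Bell basis
   only after summation over k. *)
Lemma bob_ket_sum phi i b j b' :
  \sum_(k < 4) (bob_ket phi k (tens_index i b) 0)^*%R
    * bob_ket phi k (tens_index j b') 0 =
  \sum_(k < 4) (bell R k (tens_index i b) 0)^*%R * bell R k (tens_index j b') 0
    * braket phi (pauli R k) ^+ 2.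
Proof.
have I2 : I * I = - 1 by rewrite -expr2 sqr_i.
under eq_bigr => k _ do rewrite conj_bob_ket_values bob_ket_values.
under [RHS]eq_bigr => k _ do
  rewrite conj_bell_values bell_values braket_pauli_values.
rewrite !big_ord_recl !big_ord0.
move: (phi 0 0) (phi 1 0) s I I2 => x y {}s {}I I2.
by elim/ord2P: i; elim/ord2P: b; elim/ord2P: j; elim/ord2P: b' => /=; ring: I2.
Qed.

Lemma teleport_outputE phi rho :
  braket phi (teleport_output phi rho) =
  \sum_(k < 4) braket (bell R k) rho * braket phi (pauli R k) ^+ 2.
Proof.
have -> : braket phi (teleport_output phi rho) =
    \sum_(k < 4) braket (bob_ket phi k) rho.
  rewrite {1}/braket mulmx_sumr mulmx_suml summxE.
  by apply: eq_bigr => k _; rewrite -braket_bob_ket.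
under eq_bigr => k _ do rewrite braket_tens.
under [RHS]eq_bigr => k _ do rewrite braket_tens mulr_suml.
(* Each round pushes the sum over outcomes inside one more index sum, until the entry of [rho]
   factors out and [bob_ket_sum] applies. *)
rewrite exchange_big [RHS]exchange_big; apply: eq_bigr => i _ /=.
under [RHS]eq_bigr => k _ do rewrite mulr_suml.
rewrite exchange_big [RHS]exchange_big; apply: eq_bigr => b _ /=.
under [RHS]eq_bigr => k _ do rewrite mulr_suml.
rewrite exchange_big [RHS]exchange_big; apply: eq_bigr => j _ /=.
under [RHS]eq_bigr => k _ do rewrite mulr_suml.
rewrite exchange_big [RHS]exchange_big; apply: eq_bigr => b' _ /=.
under eq_bigr => k _ do rewrite mulrAC.
under [RHS]eq_bigr => k _ do
  rewrite [_ * rho _ _ * _]mulrAC [_ * rho _ _ * _]mulrAC.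
by rewrite -!mulr_suml bob_ket_sum.
Qed.

Lemma braket_bloch_ket (t p : R) k :
  braket (bloch_ket t p) (pauli R k) =
  (nth 0 [:: 1; sin t * cos p; sin t * sin p; cos t] k)%:C.
Proof.
have x0 : bloch_ket t p 0 0 = cos (t / 2) +i* 0.
  by rewrite !mxE /= mulr0 mulr1 addr0.
have x1 : bloch_ket t p 1 0 = (sin (t / 2) * cos p) +i* (sin (t / 2) * sin p).
  rewrite !mxE /= mulr0 mulr1 add0r; apply/eqP.
  by rewrite eq_complex /= !mul0r subr0 addr0 !eqxx.
have conjE (a b : R) : (a +i* b)^*%R = a -i* b by [].
have tE : t = (t / 2) *+ 2 by rewrite -[RHS]mulr_natr divfK.
have st : sin t = cos (t / 2) * sin (t / 2) *+ 2 by rewrite {1}tE sin_mulr2n.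
have ct : cos t = cos (t / 2) ^+ 2 *+ 2 - 1 by rewrite {1}tE cos_mulr2n.
have c2 (u : R) : cos u ^+ 2 = 1 - sin u ^+ 2 by rewrite -(cos2Dsin2 u) addrK.
rewrite braket_pauli_values x0 x1 !conjE st ct.
have := c2 p; have := c2 (t / 2).
move: (cos _) (sin _) (cos p) (sin p) => c' s' Cp Sp h1 h2.
by case: k => [[|[|[|[|//]]]] ?] /=; apply/eqP; rewrite eq_complex /=;
  apply/andP; split; apply/eqP; ring: h1 h2.
Qed.

(** The Bell vectors form an orthonormal basis; this is checked on coordinates. *)
Lemma sum_bell_braket rho : \sum_(k < 4) braket (bell R k) rho = \tr rho.
Proof.
have s2 : s * s = 2^-1.
  rewrite -rmorphM -invfM -expr2 sqr_sqrtr ?ler0n// fmorphV; congr _^-1.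
  exact: rmorph_nat.
have I2 : I * I = - 1 by rewrite -expr2 sqr_i.
have two : 2 * (s * s) = 1 :> C by rewrite s2 divff // pnatr_eq0.
rewrite /mxtrace sum_tens_index !sum_I2.
under eq_bigr => k _ do
  rewrite braket_tens !sum_I2 !conj_bell_values !bell_values.
rewrite !big_ord_recl !big_ord0 /=.
move: s s2 I I2 two => {}s _ {}I I2 two.
ring: I2 two.
Qed.

(** With p_k the Bell weights, [sphere_average] gives p_0 + (p_1 + p_2 + p_3) / 3, and the p_k add
    up to the trace. *)
Lemma average_fidelityE rho :
  average_fidelity rho =
  complex.Re (\tr rho + 2 * braket (bell R ord0) rho) / 3.
Proof.
have [p pE] : exists p : 'I_4 -> C, forall k, braket (bell R k) rho = p k.
  by exists (fun k => braket (bell R k) rho).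
pose k1 : 'I_4 := lift ord0 ord0.
pose k2 : 'I_4 := lift ord0 (lift ord0 ord0).
pose k3 : 'I_4 := lift ord0 (lift ord0 (lift ord0 ord0)).
have ReD (z w : C) : complex.Re (z + w) = complex.Re z + complex.Re w.
  by case: z w => [a b] [c d].
have ReM (z : C) (r : R) : complex.Re (z * r%:C) = complex.Re z * r.
  by case: z => a b /=; rewrite mulr0 subr0.
have fid t f : teleport_fidelity (bloch_ket t f) rho =
    complex.Re (p ord0) + complex.Re (p k1) * (sin t * cos f) ^+ 2
    + complex.Re (p k2) * (sin t * sin f) ^+ 2
    + complex.Re (p k3) * cos t ^+ 2.
  rewrite /teleport_fidelity -/(braket _ _) teleport_outputE.
  under eq_bigr => k _ do rewrite pE braket_bloch_ket -rmorphXn.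
  rewrite sum_I4 /= !ReD !ReM [1 ^+ 2]expr1n.
  by congr (_ + _ + _ + _); exact: mulr1.
rewrite /average_fidelity.
under eq_Rintegral => t _ do under eq_Rintegral => f _ do rewrite fid.
have Re2 (z : C) : complex.Re (2 * z) = 2 * complex.Re z.
  by rewrite mulr_natl raddfMn mulr_natl.
rewrite sphere_average -sum_bell_braket pE (eq_bigr p) //.
rewrite sum_I4 !ReD Re2.
by field.
Qed.
End Fidelity.

(** * Channels and partial transposition *)

Section Channel.
Variable R : realType.
Local Notation C := R[i].

(** |a|^2 + |e|^2 >= 2|a||e| >= 2(|b||c| - |ae - bc|), while the cross terms are at least
    -2|b||c|. *)
Lemma norm_cross_le (a b c e : C) :
  - (2 * `|a * e - b * c|) <=
  `|a| ^+ 2 + `|e| ^+ 2 + (c^*%R * b + b^*%R * c).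
Proof.
have bc : - (2 * (`|b| * `|c|)) <= c^*%R * b + b^*%R * c.
  have xr : c^*%R * b + b^*%R * c \is Num.real.
    have -> : b^*%R * c = (c^*%R * b)^*%R by rewrite rmorphM /= conjCK mulrC.
    by rewrite CrealE rmorphD /= conjCK addrC.
  rewrite lerNl; apply: le_trans (_ : `|- (c^*%R * b + b^*%R * c)| <= _).
    by apply: real_ler_norm; rewrite realN.
  rewrite normrN; apply: le_trans (ler_normD _ _) _.
  by rewrite !normrM !norm_conjC [`|c| * _]mulrC -mulr2n mulr_natl.
have ae : `|b| * `|c| - `|a * e - b * c| <= `|a| * `|e|.
  rewrite lerBlDr -!normrM.
  have -> : `|b * c| = `|a * e - (a * e - b * c)| by congr (`|_|); ring.
  exact: ler_normB.
have amgm : 2 * (`|a| * `|e|) <= `|a| ^+ 2 + `|e| ^+ 2.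
  rewrite -subr_ge0 (_ : _ - _ = (`|a| - `|e|) ^+ 2); last by ring.
  by rewrite real_exprn_even_ge0 // rpredB // normr_real.
apply: le_trans (lerD amgm bc).
rewrite -subr_ge0 (_ : _ - _ =
  2 * (`|a| * `|e| - (`|b| * `|c| - `|a * e - b * c|))); last by ring.
by rewrite mulr_ge0 ?ler0n // subr_ge0.
Qed.

Lemma norm_det_le (a b c e : C) : 2 * `|a * e - b * c| <=
  `|a| ^+ 2 + `|b| ^+ 2 + (`|c| ^+ 2 + `|e| ^+ 2).
Proof.
have amgm (x y : C) : 2 * `|x * y| <= `|x| ^+ 2 + `|y| ^+ 2.
  rewrite normrM -subr_ge0 (_ : _ - _ = (`|x| - `|y|) ^+ 2); last by ring.
  by rewrite real_exprn_even_ge0 // rpredB // normr_real.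
rewrite (_ : _ + _ = (`|a| ^+ 2 + `|e| ^+ 2) + (`|b| ^+ 2 + `|c| ^+ 2)).
  apply: le_trans (lerD (amgm a e) (amgm b c)); rewrite -mulrDr.
  by rewrite ler_pM2l ?ltr0n // -[`|b * c|]normrN ler_normD.
by ring.
Qed.

(** The (i, j) block of the projector on the vector with coefficient matrix G. *)
Definition outer (G : 'M[C]_2) (i j : 'I_2) : 'M[C]_2 :=
  \matrix_(k, l) (G i k * (G j l)^*%R).

(* The partial transpose (on the first qubit) of the state with coefficient
   matrix G, shifted by |det G| times the identity. *)
Definition transposed_state (G : 'M[C]_2) : 'M[C]_(2 * 2) :=
  \matrix_(k, l) (outer G (tens_unindex l).1 (tens_unindex k).1
                    (tens_unindex k).2 (tens_unindex l).2
                  + `|\det G| * (k == l)%:R).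

Lemma transposed_stateE (G : 'M[C]_2) i b j b' :
  transposed_state G (tens_index i b) (tens_index j b') =
  G j b * (G i b')^*%R + `|\det G| * ((i == j) && (b == b'))%:R.
Proof.
rewrite !mxE !mxtens.mxtens_indexK /=; congr (_ + _ * _%:R).
by rewrite (can_eq (@mxtens.mxtens_indexK 2 2)) xpair_eqE.
Qed.

Lemma det2 (G : 'M[C]_2) : \det G = G 0 0 * G 1 1 - G 0 1 * G 1 0.
Proof.
rewrite (expand_det_row _ 0) sum_I2 /cofactor !det_mx11 !mxE /=.
have -> : lift 0 0 = 1 :> 'I_2 by apply: val_inj.
have -> : lift 1 0 = 0 :> 'I_2 by apply: val_inj.
by ring.
Qed.

(** With W the coefficient matrix of the test vector, the unshifted form depends only on c = conj(G)
    W^T, and [norm_cross_le] bounds it below by -2|det c| = -2|det G||det W|. By [norm_det_le] the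
    shift compensates this. *)
Lemma psdmx_transposed_state (G : 'M[C]_2) : psdmx (transposed_state G).
Proof.
move=> w; rewrite -/(braket _ _) braket_tens.
pose W j b := w (tens_index j b) 0.
pose c i j := \sum_b (G i b)^*%R * W j b.
have -> : \sum_i \sum_b \sum_j \sum_b'
    (w (tens_index i b) 0)^*%R
    * transposed_state G (tens_index i b) (tens_index j b')
    * w (tens_index j b') 0 =
    `|c 0 0| ^+ 2 + `|c 1 1| ^+ 2
    + ((c 1 0)^*%R * c 0 1 + (c 0 1)^*%R * c 1 0)
    + `|\det G| * (`|W 0 0| ^+ 2 + `|W 0 1| ^+ 2
                   + (`|W 1 0| ^+ 2 + `|W 1 1| ^+ 2)).
  rewrite !sum_I2 !transposed_stateE !normCK /c !sum_I2.
  rewrite !(rmorphD, rmorphM) /= !conjCK /= -!/(W _ _).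
  move: `|\det G| => d.
  by ring.
have detE : c 0 0 * c 1 1 - c 0 1 * c 1 0 =
    (\det G)^*%R * (W 0 0 * W 1 1 - W 0 1 * W 1 0).
  rewrite det2 /c !sum_I2 rmorphB !rmorphM /=; ring.
have := norm_cross_le (c 0 0) (c 0 1) (c 1 0) (c 1 1).
rewrite detE normrM norm_conjC => h1.
have h2 := norm_det_le (W 0 0) (W 0 1) (W 1 0) (W 1 1).
apply: le_trans (lerD h1 (ler_wpM2l (normr_ge0 (\det G)) h2)).
by rewrite mulrCA addNr.
Qed.

Definition coefmx (Psi : 'cV[C]_(2 * 2)) : 'M[C]_2 :=
  \matrix_(i, k) Psi (tens_index i k) 0.

Lemma id_tensE (L : 'M[C]_2 -> 'M[C]_2) n (X : 'M[C]_(n * 2)) i b j b' :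
  id_tens L X (tens_index i b) (tens_index j b') =
  L (\matrix_(k, l) X (tens_index i k) (tens_index j l)) b b'.
Proof. by rewrite mxE !mxtens.mxtens_indexK. Qed.

Lemma id_tens_proj (L : 'M[C]_2 -> 'M[C]_2) (Psi : 'cV[C]_(2 * 2)) i b j b' :
  id_tens L (proj Psi) (tens_index i b) (tens_index j b') =
  L (outer (coefmx Psi) i j) b b'.
Proof.
rewrite id_tensE; congr (L _ b b').
by apply/matrixP => k l; rewrite !mxE big_ord1 !mxE.
Qed.

Lemma outer_mulmx (M A : 'M[C]_2) b b' :
  outer (M *m A) b b' =
  \sum_i \sum_j (M b i * (M b' j)^*%R) *: outer A i j.
Proof.
apply/matrixP => k l; rewrite !sum_I2 !mxE !sum_I2 rmorphD !rmorphM /=; ring.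
Qed.

(** By linearity of [L] the coefficients of the test vector move inside the channel, where they
    recombine the rows of the coefficient matrix. *)
Lemma braket_id_tens (L : {linear 'M[C]_2 -> 'M[C]_2}) Psi
    (z : 'cV[C]_(2 * 2)) (Q : 'M[C]_2) :
  (forall i b, z (tens_index i b) 0 = Q i b) ->
  braket z (id_tens L (proj Psi)) =
  \sum_b \sum_b' L (outer (Q^t* *m coefmx Psi) b b') b b'.
Proof.
move=> zQ; rewrite braket_tens exchange_big; apply: eq_bigr => b _ /=.
rewrite exchange_big [LHS]exchange_big.
under eq_bigr => i _ do under eq_bigr => j _ do under eq_bigr => b' _ do
  rewrite id_tens_proj !zQ.
under eq_bigr => i _ do rewrite exchange_big /=.
rewrite exchange_big; apply: eq_bigr => b' _ /=.
rewrite outer_mulmx linear_sum summxE; apply: eq_bigr => i _.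
rewrite linear_sum summxE; apply: eq_bigr => j _.
by rewrite linearZ mxE !adjmxE conjCK mulrAC.
Qed.

Lemma channel_bound (L : {linear 'M[C]_2 -> 'M[C]_2}) (G : 'M[C]_2) :
  qubit_channel L ->
  \sum_b \sum_b' L (outer G b b') b b' <=
  \sum_b \sum_k `|G b k| ^+ 2 + 2 * `|\det G|.
Proof.
move=> [cpL tpL].
have entryE i b j b' :
    id_tens L (transposed_state G) (tens_index i b) (tens_index j b') =
    L (outer G j i) b b' + `|\det G| * (i == j)%:R * L 1%:M b b'.
  rewrite id_tensE.
  have -> : \matrix_(k, l)
      transposed_state G (tens_index i k) (tens_index j l) =
      outer G j i + (`|\det G| * (i == j)%:R) *: 1%:M.
    apply/matrixP => k l; rewrite [LHS]mxE transposed_stateE !mxE.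
    by rewrite -mulrA -natrM mulnb.
  by rewrite linearD linearZ !mxE.
pose v : 'cV[C]_(2 * 2) := ket R 0 *t ket R 1 - ket R 1 *t ket R 0.
have vE i b : v (tens_index i b) 0 =
    ((i == 0) && (b == 1))%:R - ((i == 1) && (b == 0))%:R.
  by rewrite !mxE !mxtens.mxtens_indexK /= !andbT -!natrM !mulnb.
have := cpL _ _ (psdmx_transposed_state G) v; rewrite -/(braket _ _).
rewrite braket_tens !sum_I2 !vE !entryE /=.
have tr2 (X : 'M[C]_2) : \tr X = X 0 0 + X 1 1 by rewrite /mxtrace sum_I2.
have := tpL 1%:M; rewrite !tr2 !mxE /= => t1.
have := tpL (outer G 0 0); rewrite !tr2 !mxE -!normCK => t00.
have := tpL (outer G 1 1); rewrite !tr2 !mxE -!normCK => t11.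
have {}t1 : L 1%:M 1 1 = 2 - L 1%:M 0 0 by rewrite -[2]t1 addrC addKr.
have {}t00 : L (outer G 0 0) 1 1 =
    `|G 0 0| ^+ 2 + `|G 0 1| ^+ 2 - L (outer G 0 0) 0 0.
  by rewrite -t00 addrC addKr.
have {}t11 : L (outer G 1 1) 1 1 =
    `|G 1 0| ^+ 2 + `|G 1 1| ^+ 2 - L (outer G 1 1) 0 0.
  by rewrite -t11 addrC addKr.
(* The off-diagonal terms enter the form at [v] with a minus sign; once trace preservation
   eliminates the entries (1, 1), the form is exactly the slack of the claimed inequality. *)
rewrite t1 t00 t11 => pos; rewrite -subr_ge0; apply: etrans pos; congr (0 <= _).
rewrite !subr0 !sub0r !rmorphN rmorph0 rmorph1 /= ?conjC0 ?conjC1.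
ring.
Qed.

End Channel.

(** * The maximal average fidelity *)

Section MaxFidelity.
Variable R : realType.
Local Notation C := R[i].
Implicit Types (Psi : 'cV[C]_(2 * 2)) (rho : 'M[C]_(2 * 2)) (U V Q G : 'M[C]_2).
Local Notation s := (((Num.sqrt 2)^-1)%:C : C).

Lemma trmx_conj_tens m n p q (A : 'M[C]_(m, n)) (B : 'M[C]_(p, q)) :
  (A *t B)^t* = A^t* *t B^t*.
Proof. by apply/matrixP => i j; rewrite !mxE rmorphM. Qed.

Lemma tens1mx1 m n : (1%:M : 'M[C]_m) *t (1%:M : 'M[C]_n) = 1%:M.
Proof.
apply/matrixP => i j.
case: (mxtens.mxtens_indexP i) => i1 i2.
case: (mxtens.mxtens_indexP j) => j1 j2.
rewrite mxtens.tensmxE !mxE -natrM mulnb.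
by rewrite (can_eq (@mxtens.mxtens_indexK m n)) xpair_eqE.
Qed.

Lemma mxtrace_local_unitary (U V : 'M[C]_2) rho :
  U \is unitarymx -> V \is unitarymx -> \tr (local_unitary U V rho) = \tr rho.
Proof.
(* [unitarymxP] gives U U' = 1, whereas cyclicity of the trace calls for U' U = 1; hence the passage
   to the adjoints. *)
rewrite -(trmxC_unitary U) -(trmxC_unitary V) => /unitarymxP + /unitarymxP.
rewrite !trmxCK => Uu Vu.
rewrite /local_unitary mxtrace_mulC mulmxA trmx_conj_tens mxtens.tensmx_mul.
by rewrite Uu Vu tens1mx1 mul1mx.
Qed.

Lemma braket_local_unitary (U V : 'M[C]_2) z rho :
  braket z (local_unitary U V rho) = braket ((U *t V)^t* *m z) rho.
Proof.
have zE : ((U *t V)^t* *m z)^t* = z^t* *m (U *t V).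
  by rewrite trmx_mul map_mxM trmxCK.
by rewrite /braket zE /local_unitary !mulmxA.
Qed.

Lemma braketZ n (c : C) (z : 'cV[C]_n) X :
  braket (c *: z) X = `|c| ^+ 2 * braket z X.
Proof.
rewrite !braketE mulr_sumr; apply: eq_bigr => i _; rewrite mulr_sumr.
by apply: eq_bigr => j _; rewrite !mxE normCK rmorphM /=; ring.
Qed.

(** The coefficient matrix of |01> - |10>. *)
Definition eps2 : 'M[C]_2 := mx22 0 1 (-1) 0.

(* The coefficient matrix of sqrt 2 times the singlet rotated by U^-1 (x) V^-1;
   it is U^t* eps2 times the entrywise conjugate of V. *)
Definition rotated_singlet (U V : 'M[C]_2) : 'M[C]_2 :=
  U^t* *m eps2 *m (V^t*)^T.

Lemma eps2_unitary : eps2 \is unitarymx.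
Proof.
apply/unitarymxP/matrixP; elim/ord2P; elim/ord2P;
  by rewrite !mxE sum_I2 !mxE /= ?rmorphN ?rmorph0 ?rmorph1 /=; ring.
Qed.

Lemma rotated_singlet_unitary (U V : 'M[C]_2) :
  U \is unitarymx -> V \is unitarymx -> rotated_singlet U V \is unitarymx.
Proof.
rewrite -(trmxC_unitary U) -(trmxC_unitary V) -(trmx_unitary (V^t*)) => Uu Vu.
exact: mul_unitarymx (mul_unitarymx Uu eps2_unitary) Vu.
Qed.

(** This is (M (x) N) vec(X) = vec(M X N^T), where vec(X) has coefficient matrix X. *)
Lemma local_bell (U V : 'M[C]_2) :
  (U *t V)^t* *m bell R ord0 =
  s *: \col_k rotated_singlet U V (tens_unindex k).1 (tens_unindex k).2.
Proof.
apply/matrixP => k l; rewrite [l]ord1 {l}.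
case: (mxtens.mxtens_indexP k) => i b.
rewrite mxE sum_tens_index [RHS]mxE [(\col__ _) _ _]mxE mxtens.mxtens_indexK /=.
rewrite trmx_conj_tens !sum_I2 !mxtens.tensmxE !bell_values /=.
rewrite /rotated_singlet [(_ *m _) _ _]mxE sum_I2 ![(_ *m eps2) _ _]mxE !sum_I2.
rewrite ![eps2 _ _]mxE ![(_^T) _ _]mxE /=.
rewrite ![map_mx _ _ _ _]mxE ![(_^T) _ _]mxE; ring.
Qed.

Lemma sum_norm_coefmx (Psi : 'cV[C]_(2 * 2)) : pure_state Psi ->
  \sum_i \sum_k `|coefmx Psi i k| ^+ 2 = 1.
Proof.
move=> /matrixP /(_ 0 0) Psi1.
have <- : (1%:M : 'M[C]_1) 0 0 = 1 by rewrite mxE eqxx.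
rewrite -Psi1 [RHS]mxE sum_tens_index.
apply: eq_bigr => i _; apply: eq_bigr => k _.
by rewrite mxE normCK adjmxE mulrC.
Qed.

Lemma mxtrace_id_tens_proj (L : 'M[C]_2 -> 'M[C]_2) Psi :
  pure_state Psi -> trace_preserving L -> \tr (id_tens L (proj Psi)) = 1.
Proof.
move=> Psi1 tpL; rewrite /mxtrace sum_tens_index -(sum_norm_coefmx Psi1).
apply: eq_bigr => i _; under eq_bigr => b _ do rewrite id_tens_proj.
rewrite -[LHS]/(\tr _) tpL; apply: eq_bigr => k _.
by rewrite mxE normCK.
Qed.

(** The weight 2 of the singlet overlap cancels the squared normalisation 1/2 of the Bell vector. *)
Lemma average_fidelity_local (L : {linear 'M[C]_2 -> 'M[C]_2}) Psi U V
    (G := (rotated_singlet U V)^t* *m coefmx Psi) :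
  pure_state Psi -> trace_preserving L -> U \is unitarymx -> V \is unitarymx ->
  average_fidelity (local_unitary U V (id_tens L (proj Psi))) =
  complex.Re (1 + \sum_b \sum_b' L (outer G b b') b b') / 3.
Proof.
move=> Psi1 tpL Uu Vu.
rewrite average_fidelityE mxtrace_local_unitary // mxtrace_id_tens_proj //.
rewrite braket_local_unitary local_bell braketZ.
rewrite (braket_id_tens L Psi (Q := rotated_singlet U V)); last first.
  by move=> i b; rewrite mxE mxtens.mxtens_indexK.
have s2 : `|s| ^+ 2 = 2^-1.
  rewrite normCK (_ : s^*%R = s) -?rmorphM -?invfM -?expr2.
    by rewrite sqr_sqrtr ?ler0n // fmorphV; congr _^-1; exact: rmorph_nat.
  exact: conjc_real.
by rewrite s2 mulVKf ?pnatr_eq0.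
Qed.

Lemma sum_norm_unitary_mulmx (Q A : 'M[C]_2) : Q \is unitarymx ->
  \sum_i \sum_k `|(Q^t* *m A) i k| ^+ 2 = \sum_i \sum_k `|A i k| ^+ 2.
Proof.
have normE (M : 'M[C]_2) : \sum_i \sum_k `|M i k| ^+ 2 = \tr (M *m M^t*).
  apply: eq_bigr => i _; rewrite mxE; apply: eq_bigr => k _.
  by rewrite adjmxE normCK.
move=> /unitarymxP Qu; rewrite !normE trmx_mul map_mxM trmxCK.
by rewrite mulmxA mxtrace_mulC !mulmxA Qu mul1mx.
Qed.

Lemma norm_det_unitary_mulmx (Q A : 'M[C]_2) : Q \is unitarymx ->
  `|\det (Q^t* *m A)| = `|\det A|.
Proof.
move=> /unitarymxP /(congr1 determinant).
rewrite det_mulmx det1 det_map_mx det_tr /= => detQ.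
have /eqP : `|\det Q| ^+ 2 = 1 by rewrite normCK.
rewrite sqrp_eq1 // => /eqP detQ1.
by rewrite det_mulmx det_map_mx det_tr normrM norm_conjC detQ1 mul1r.
Qed.

(** Apply [channel_bound] to G = Q'A, with Q the rotated singlet: G has the Frobenius norm and the
    |det| of A, so the bound is the same for all U, V and [L]. *)
Lemma average_fidelity_le (L : {linear 'M[C]_2 -> 'M[C]_2}) Psi U V :
  pure_state Psi -> qubit_channel L -> U \is unitarymx -> V \is unitarymx ->
  average_fidelity (local_unitary U V (id_tens L (proj Psi))) <=
  complex.Re (1 + (1 + 2 * `|\det (coefmx Psi)|)) / 3.
Proof.
move=> Psi1 chL Uu Vu; rewrite average_fidelity_local //; last by case: chL.
rewrite ler_pM2r ?invr_gt0 ?ltr0n //.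
set G := _ *m _.
have := channel_bound G chL.
have Qu := rotated_singlet_unitary Uu Vu.
rewrite sum_norm_unitary_mulmx // norm_det_unitary_mulmx // sum_norm_coefmx //.
(* An inequality in C also says that the imaginary parts agree; only its real part is kept. *)
by rewrite -(lerD2l 1) lecE => /andP[].
Qed.
End MaxFidelity.

(** * The polar factor of a 2x2 matrix *)

Section Attained.
Variable R : realType.
Local Notation C := R[i].
Implicit Types (Psi : 'cV[C]_(2 * 2)) (rho : 'M[C]_(2 * 2)) (U V Q G : 'M[C]_2).

Lemma phase_exists (d : C) : exists2 u : C, u * u^*%R = 1 & u^*%R * d = `|d|.
Proof.
have [->|d0] := eqVneq d 0.
  by exists 1; rewrite ?conjC1 ?mulr1 // mulr0 normr0.
have nd0 : `|d| != 0 by rewrite normr_eq0.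
exists (d / `|d|); rewrite rmorphM /= fmorphV /= conj_normC.
  by rewrite mulrACA -normCK -invfM -expr2 divff // expf_neq0.
by rewrite mulrAC [_ * d]mulrC -normCK expr2 mulfK.
Qed.

(** The double sum is |tr(Q'A)|^2. Since W W' = sigma I and tr(W'A) = sigma, the choice Q = W /
    sqrt(sigma) gives the trace sqrt(sigma). Positivity of N makes sigma invertible. *)
Lemma polar_factor_attains (A : 'M[C]_2) (N := \sum_i \sum_k `|A i k| ^+ 2) :
  0 < N ->
  exists2 Q : 'M[C]_2, Q \is unitarymx &
    \sum_b \sum_b' outer (Q^t* *m A) b b' b b' = N + 2 * `|\det A|.
Proof.
move=> N0; have [u u1 ud] := phase_exists (\det A).
set sigma := N + _.
have sigma0 : 0 < sigma by rewrite ltr_pwDl // mulr_ge0 ?ler0n.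
have sigmaR : sigma^*%R = sigma by apply/CrealP/ger0_real/ltW.
pose r := (sqrtC sigma)^-1.
have rR : r^*%R = r.
  by apply/CrealP/ger0_real; rewrite invr_ge0 sqrtC_ge0 ltW.
have r2 : r * r * sigma = 1.
  by rewrite /r -invfM -expr2 sqrtCK mulVf // gt_eqF.
have ud' : u * (\det A)^*%R = `|\det A|.
  by rewrite -[RHS]conj_normC -ud rmorphM /= conjCK.
pose a := A 0 0; pose b := A 0 1; pose c := A 1 0; pose e := A 1 1.
pose W : 'M[C]_2 := mx22 (a + u * e^*%R) (b - u * c^*%R)
                         (c - u * b^*%R) (e + u * a^*%R).
have NE : N = a * a^*%R + b * b^*%R + (c * c^*%R + e * e^*%R).
  by rewrite /N !sum_I2 !normCK.
have sE : sigma = a * a^*%R + b * b^*%R + (c * c^*%R + e * e^*%R)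
    + (u^*%R * (a * e - b * c) + u * (a^*%R * e^*%R - b^*%R * c^*%R)).
  rewrite /sigma NE mulr_natl mulr2n -{1}ud -ud' det2 rmorphB !rmorphM /=.
  by rewrite addrA.
(* The conjugate of u times det A is the real number |det A|, hence its own conjugate. *)
have udE : u^*%R * (a * e - b * c) = u * (a^*%R * e^*%R - b^*%R * c^*%R).
  by move: ud'; rewrite -ud det2 rmorphB !rmorphM /= => <-.
exists (r *: W).
  apply/unitarymxP/matrixP; elim/ord2P; elim/ord2P;
    rewrite mxE sum_I2 !adjmxE ![(r *: W) _ _]mxE ![W _ _]mxE [RHS]mxE /=;
    rewrite !rmorphM ?rmorphB ?rmorphD /= !rmorphM /= !conjCK rR;
    rewrite -/a -/b -/c -/e.
  - by rewrite -r2 sE; ring: u1.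
  - by ring: u1.
  - by ring: u1.
  - by rewrite -r2 sE; ring: u1.
set G := _ *m A.
have trG : G 0 0 + G 1 1 = r * sigma.
  rewrite /G !mxE !sum_I2 !adjmxE ![(r *: W) _ _]mxE ![W _ _]mxE /=.
  rewrite !rmorphM ?rmorphB ?rmorphD /= !rmorphM /= !conjCK rR.
  rewrite -/a -/b -/c -/e sE -udE; ring.
have -> : \sum_b \sum_b' outer G b b' b b' =
    (G 0 0 + G 1 1) * (G 0 0 + G 1 1)^*%R.
  by rewrite !sum_I2 !mxE rmorphD /=; ring.
rewrite trG rmorphM /= rR sigmaR.
by rewrite -[RHS]mul1r -r2; ring.
Qed.
End Attained.

(** * The identity channel and the value for the initial state *)

Section Conclusion.
Variable R : realType.
Local Notation C := R[i].
Implicit Types (Psi : 'cV[C]_(2 * 2)).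

Lemma id_tens_idfun n (X : 'M[C]_(n * 2)) :
  id_tens (idfun : 'M[C]_2 -> 'M[C]_2) X = X.
Proof.
apply/matrixP => k l.
case: (mxtens.mxtens_indexP k) => i b; case: (mxtens.mxtens_indexP l) => j b'.
by rewrite id_tensE !mxE.
Qed.

Lemma qubit_channel_idfun : qubit_channel (idfun : {linear 'M[C]_2 -> 'M[C]_2}).
Proof. by split=> [n X|X]; rewrite ?id_tens_idfun. Qed.

Lemma average_fidelity_attained Psi : pure_state Psi ->
  exists U V : 'M[C]_2, [/\ U \is unitarymx, V \is unitarymx &
    average_fidelity (local_unitary U V (proj Psi)) =
    complex.Re (1 + (1 + 2 * `|\det (coefmx Psi)|)) / 3].
Proof.
move=> Psi1; have N1 := sum_norm_coefmx Psi1.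
have [|Q Qu QE] := polar_factor_attains (A := coefmx Psi).
  by rewrite N1 ltr01.
have eps2K : (eps2 R)^t* *m eps2 R = 1%:M.
  by apply: mulmx1C; apply/unitarymxP; exact: eps2_unitary.
(* Solves U' eps2 = Q, so that rotating Alice's side alone already realises Q. *)
pose U : 'M[C]_2 := (Q *m (eps2 R)^t*)^t*.
have Uu : U \is unitarymx.
  rewrite trmxC_unitary; apply: (mul_unitarymx Qu).
  rewrite trmxC_unitary; exact: eps2_unitary.
have V1 : (1%:M : 'M[C]_2) \is unitarymx.
  by apply/unitarymxP; rewrite trmx1 map_mx1 mul1mx.
have rotQ : rotated_singlet U 1%:M = Q.
  rewrite /rotated_singlet trmxCK trmx1 map_mx1 trmx1 mulmx1.
  by rewrite -mulmxA eps2K mulmx1.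
exists U, 1%:M; split=> //.
rewrite -[proj Psi]id_tens_idfun.
have [_ tp] := qubit_channel_idfun.
by rewrite (average_fidelity_local Psi1 tp Uu V1) rotQ QE N1.
Qed.

End Conclusion.

Theorem proposition7 (R : realType) (Psi : 'cV[R[i]]_(2 * 2))
    (Lambda : {linear 'M[R[i]]_2 -> 'M[R[i]]_2})
    (Psi_pure : pure_state Psi)
    (Psi_entangled : entangled Psi)
    (Psi_not_maximal : ~ maximally_entangled Psi)
    (Lambda_channel : qubit_channel Lambda) :
  max_average_fidelity (id_tens Lambda (proj Psi)) <=
  max_average_fidelity (proj Psi).
Proof.
have [U [V [Uu Vu UVE]]] := average_fidelity_attained Psi_pure.
have unitary1 : (1%:M : 'M[R[i]]_2) \is unitarymx.
  by apply/unitarymxP; rewrite trmx1 map_mx1 mul1mx.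
(* The middle term depends only on [Psi]: it bounds every value for the final state and is a value
   for the initial one. *)
apply: (@le_trans _ _ (complex.Re (1 + (1 + 2 * `|\det (coefmx Psi)|)) / 3)).
  apply: ge_sup.
    (* Bounding a supremum from above requires a nonempty set; identity unitaries provide a
       member. *)
    exists (average_fidelity
      (local_unitary 1%:M 1%:M (id_tens Lambda (proj Psi)))).
    by exists 1%:M, 1%:M.
  move=> _ [U' [V' [U'u V'u ->]]]; exact: average_fidelity_le.
rewrite -UVE; apply: ub_le_sup; last by exists U, V.
(* A member lies below the supremum only once the set is bounded; the bound is that of the identity
   channel. *)
exists (complex.Re (1 + (1 + 2 * `|\det (coefmx Psi)|)) / 3).
move=> _ [U' [V' [U'u V'u ->]]]; rewrite -[proj Psi]id_tens_idfun.
exact: average_fidelity_le (qubit_channel_idfun R) U'u V'u.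
Qed.
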